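(* There are no timelike meridian surfaces of hyperbolic type (of first or second kind) in $\mathbb{R}^4_1$ with parallel mean curvature vector field $H$, $H\neq0$, other than CMC-surfaces lying in a hyperplane of $\mathbb{R}^4_1$. That is, every non-minimal timelike first or second kind meridian surface of hyperbolic type whose mean curvature vector field $H$ satisfies $DH=0$ is a CMC-surface ($\langle H,H\rangle=\mathrm{const}\neq0$) lying in a hyperplane of $\mathbb{R}^4_1$.
   Context: $\mathbb{R}^4_1$ is the Minkowski 4-space with metric $\langle\cdot,\cdot\rangle = dx_1^2+dx_2^2+dx_3^2-dx_4^2$ and standard orthonormal frame $e_1,e_2,e_3,e_4$ ($e_4$ timelike). $I,J\subset\mathbb{R}$ are intervals, $f,g:I\to\mathbb{R}$ are smooth with $f>0$; dot $=d/du$, prime $=d/dv$. Both kinds of surface are parametrized by $z(u,v)=f(u)l(v)+g(u)e_1$, $u\in I$, $v\in J$. First kind: $\dot f^2+\dot g^2\neq0$ and $l:J\to\mathbb{S}^2_1(1)=\{V\in\mathrm{span}\{e_2,e_3,e_4\}:\langle V,V\rangle=1\}$ is a smooth timelike curve with $\langle l',l'\rangle=-1$. Timelike second kind: $\dot f^2-\dot g^2>0$ and $l:J\to\mathbb{H}^2(-1)=\{V\in\mathrm{span}\{e_2,e_3,e_4\}:\langle V,V\rangle=-1,\ e_4\text{-coordinate}>0\}$ is a smooth curve with $\langle l',l'\rangle=1$. In both cases the induced metric is Lorentzian. $H=\frac12(\sigma(x,x)-\sigma(y,y))$ is the mean curvature vector field, $\sigma$ being the second fundamental form and $\{x,y\}$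 an orthonormal tangent frame with $\langle x,x\rangle=1$, $\langle y,y\rangle=-1$. $D$ is the normal connection; $H$ is parallel if $DH=0$. The surface is minimal if $H=0$ identically, and a CMC-surface if $\langle H,H\rangle$ is a non-zero constant. *)

(* Defs.v *)
From HB Require Import structures.
From mathcomp Require Import all_boot all_order all_algebra.
From mathcomp Require Import all_classical all_reals all_analysis.
Set Implicit Arguments.
Unset Strict Implicit.
Unset Printing Implicit Defensive.
Import Order.TTheory GRing.Theory Num.Theory.
Import numFieldNormedType.Exports.
Local Open Scope ring_scope.
Local Open Scope classical_set_scope.

Section Minkowski.
Context {R : realType}.
Implicit Types (x y : 'rV[R]_4).

(* Coordinates are 0-based: e1, e2, e3 are spacelike, e4 is timelike. *)
Definition mink x y : R :=
  x 0 0 * y 0 0 + x 0 1 * y 0 1 + x 0 2 * y 0 2 - x 0 3 * y 0 3.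

Definition e1 : 'rV[R]_4 := delta_mx 0 0.
Definition e2 : 'rV[R]_4 := delta_mx 0 1.
Definition e3 : 'rV[R]_4 := delta_mx 0 2.
Definition e4 : 'rV[R]_4 := delta_mx 0 3.

Definition span_e2_e3_e4 : {vspace 'rV[R]_4} := <<[:: e2; e3; e4]>>%VS.

Definition deSitter2 : set 'rV[R]_4 :=
  [set V | V \in span_e2_e3_e4 /\ mink V V = 1].

Definition hyperbolic2 : set 'rV[R]_4 :=
  [set V | [/\ V \in span_e2_e3_e4, mink V V = -1 & 0 < V 0 3]].

(* Affine hyperplanes, not necessarily through the origin. *)
Definition is_hyperplane (P : set 'rV[R]_4) : Prop :=
  exists (p : 'rV[R]_4) (W : {vspace 'rV[R]_4}),
    \dim W = 3%N /\ P = [set p + w | w in [set w | w \in W]].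

End Minkowski.

Section Smoothness.
Context {R : realType}.

Definition nondegenerate_interval (I : set R) : Prop :=
  is_interval I /\ exists a b, [/\ I a, I b & a < b].

(* The interval A need not be open: smoothness on A means smoothness on some
   open neighbourhood of A, so that at an endpoint belonging to A the
   two-sided derivatives below exist and agree with the one-sided derivatives
   of the restriction to A. *)
Definition smooth_on (V : normedModType R) (A : set R) (h : R -> V) : Prop :=
  exists U : set R, [/\ open U, A `<=` U &
    forall (n : nat) (x : R), U x -> derivable (derive1n n h) x 1].

End Smoothness.

Section Surface.
Context {R : realType}.
(* A vector field along the parametrized surface z is a map
   (u, v) |-> W u v; a tangent vector of z at (u, v) is given by its pair of
   components X in the coordinate frame (z_u, z_v). *)
Implicit Types (z W : R -> R -> 'rV[R]_4) (X Y : R * R) (I J : set R).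

Definition d_u W (u v : R) : 'rV[R]_4 := derive1 (W ^~ v) u.
Definition d_v W (u v : R) : 'rV[R]_4 := derive1 (W u) v.

(* The flat connection of R^4_1: derivative of W in the direction X. *)
Definition flat_cov X W (u v : R) : 'rV[R]_4 :=
  X.1 *: d_u W u v + X.2 *: d_v W u v.

Definition tangent_vector z X (u v : R) : 'rV[R]_4 := flat_cov X z u v.

Definition is_tangent z (u v : R) (w : 'rV[R]_4) : Prop :=
  exists X, w = tangent_vector z X u v.

Definition is_normal z (u v : R) (w : 'rV[R]_4) : Prop :=
  forall X, mink w (tangent_vector z X u v) = 0.

(* The component n of w in the decomposition w = (tangent) + n; it exists and
   is unique when the metric induced on the tangent plane is nondegenerate. *)
Definition normal_part z (u v : R) (w : 'rV[R]_4) : 'rV[R]_4 :=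
  xget 0 [set n | is_normal z u v n /\ is_tangent z u v (w - n)].

(* Gauss formula: Y is extended to the field with constant components in the
   coordinate frame. *)
Definition second_fundamental_form z (u v : R) X Y : 'rV[R]_4 :=
  normal_part z u v (flat_cov X (tangent_vector z Y) u v).

Definition lorentz_frame z (u v : R) X Y : Prop :=
  [/\ mink (tangent_vector z X u v) (tangent_vector z X u v) = 1,
      mink (tangent_vector z Y u v) (tangent_vector z Y u v) = -1 &
      mink (tangent_vector z X u v) (tangent_vector z Y u v) = 0].

(* The vector does not depend on the orthonormal frame, so the choice made by
   xget is immaterial wherever the induced metric is Lorentzian. *)
Definition mean_curvature z (u v : R) : 'rV[R]_4 :=
  xget 0 [set h | exists X Y, lorentz_frame z u v X Y /\
    h = 2^-1 *: (second_fundamental_form z u v X X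
                 - second_fundamental_form z u v Y Y)].

Definition normal_cov z X W (u v : R) : 'rV[R]_4 :=
  normal_part z u v (flat_cov X W u v).

Definition minimal_surface I J z : Prop :=
  forall u v, I u -> J v -> mean_curvature z u v = 0.

Definition parallel_mean_curvature I J z : Prop :=
  forall u v, I u -> J v ->
    forall X, normal_cov z X (mean_curvature z) u v = 0.

Definition CMC_surface I J z : Prop :=
  exists c : R, c != 0 /\
    forall u v, I u -> J v ->
      mink (mean_curvature z u v) (mean_curvature z u v) = c.

Definition lies_in_hyperplane I J z : Prop :=
  exists P, is_hyperplane P /\ forall u v, I u -> J v -> P (z u v).

End Surface.

Section Meridian.
Context {R : realType}.
Implicit Types (I J : set R) (f g : R -> R) (l : R -> 'rV[R]_4).

Definition meridian_surface f g l (u v : R) : 'rV[R]_4 :=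
  f u *: l v + g u *: e1.

Definition meridian_data I J f g l : Prop :=
  [/\ nondegenerate_interval I, nondegenerate_interval J &
      [/\ smooth_on I f, smooth_on I g, smooth_on J l &
          forall u, I u -> 0 < f u]].

Definition first_kind I J f g l : Prop :=
  [/\ meridian_data I J f g l,
      forall u, I u -> (derive1 f u) ^+ 2 + (derive1 g u) ^+ 2 != 0,
      forall v, J v -> deSitter2 (l v) &
      forall v, J v -> mink (derive1 l v) (derive1 l v) = -1].

Definition timelike_second_kind I J f g l : Prop :=
  [/\ meridian_data I J f g l,
      forall u, I u -> 0 < (derive1 f u) ^+ 2 - (derive1 g u) ^+ 2,
      forall v, J v -> hyperbolic2 (l v) &
      forall v, J v -> mink (derive1 l v) (derive1 l v) = 1].

End Meridian.

(* Main.v *)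
From HB Require Import structures.
Require Import Defs.
From mathcomp Require Import all_boot all_order all_algebra.
From mathcomp Require Import all_classical all_reals all_analysis.
From mathcomp Require Import ring lra.
Set Implicit Arguments.
Unset Strict Implicit.
Unset Printing Implicit Defensive.
Import Order.TTheory GRing.Theory Num.Theory.
Import numFieldNormedType.Exports.
Local Open Scope ring_scope.
Local Open Scope classical_set_scope.

(** The two kinds of surfaces differ only in the sign [e] of [<l, l>], which is
[1] on the de Sitter sphere and [-1] on the hyperbolic plane; in both cases
[<l', l'> = - e], and all formulas below carry this sign as a parameter.

The curve [l] has a unit normal [n] in span(e2, e3, e4), the Lorentzian cross
product of [l] and [l'], and a geodesic curvature [kappa] with
[l'' = l + kappa n] and [n' = e kappa l'].  The normal plane of the surface is
spanned by [n] and by the vector [nu = f' e1 - e g' l], and the mean curvature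
vector turns out to be
    [2 H = A nu - (e kappa / f) n],
where [A] depends on [u] only ([meridian_mean_curvature]).  The normal plane
is positive definite, so [H] vanishes wherever [<H, H>] does.

If [H] is parallel, its derivatives [H_u] and [H_v] are tangent to the
surface.  Pairing them with normal vectors gives two constants:
- [<H, H>], because its derivatives are twice the products of [H_u], [H_v]
  with the normal vector [H]; this is the CMC property, and the constant is
  not zero since the surface is not minimal ([parallel_CMC]);
- [<H, n> = - e kappa / (2 f)], because [n] does not depend on [u] and [n_v]
  is tangent ([parallel_curvature_ratio_constant]).
Since [kappa] depends on [v] alone and [f] on [u] alone, the second constant
forces [kappa] to be constant, and either [kappa = 0] or [f] is constant.  Then
[m = n - e kappa l] is a constant nonzero vector, and [<z, m> = - kappa f] is
constant: the surface lies in a hyperplane orthogonal to [m]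
([parallel_lies_in_hyperplane]).

The intervals may contain their endpoints, and at an endpoint nothing is known
about [mean_curvature] on the outer side, so [DH = 0] is used at interior
parameters only.  The explicit formula for [H], on the other hand, is
differentiable at every parameter of [I] and [J]; with the mean value theorem
this carries the constancy over to the endpoints. *)

(** * Derivatives along curves *)

Lemma is_derive_rowP (R : realType) n (h : R -> 'rV[R]_n) (dh : 'rV[R]_n)
    (t : R) :
  is_derive t 1 h dh <->
  forall j, is_derive t 1 (fun s => h s 0 j) (dh 0 j).
Proof.
split=> [[dt <-] j|H].
  apply: DeriveDef; first by move/derivable_mxP : dt; exact.
  by rewrite derive_mx // mxE.
have dt : derivable h t 1.
  by apply/derivable_mxP => i j; rewrite (ord1 i); case: (H j).
apply: DeriveDef => //; rewrite derive_mx //; apply/rowP => j.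
by rewrite mxE; case: (H j).
Qed.

Lemma is_derive_derive1 (R : realType) (V : normedModType R) (h : R -> V)
    (t : R) (dh : V) : is_derive t 1 h dh -> derive1 h t = dh.
Proof. by rewrite derive1E => -[_ <-]. Qed.

Lemma derivable_is_derive1 (R : realType) (V : normedModType R) (h : R -> V)
    (t : R) : derivable h t 1 -> is_derive t 1 h (derive1 h t).
Proof. by rewrite derive1E; exact: derivableP. Qed.

(** The rules of differentiation are stated here for functions given by an
explicit expression in the parameter, so that they can be applied to the
formulas of the surface directly. *)
Lemma is_derive1_mul (R : realType) (a b : R -> R) (t da db : R) :
  is_derive t 1 a da -> is_derive t 1 b db ->
  is_derive t 1 (fun s => a s * b s) (da * b t + a t * db).
Proof.
move=> Da Db; apply: (is_derive_eq (f := a * b)).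
by rewrite /GRing.scale /= addrC (mulrC (b t)).
Qed.

Lemma is_derive1_scale (R : realType) n (a : R -> R) (h : R -> 'rV[R]_n)
    (t da : R) (dh : 'rV[R]_n) :
  is_derive t 1 a da -> is_derive t 1 h dh ->
  is_derive t 1 (fun s => a s *: h s) (da *: h t + a t *: dh).
Proof.
move=> Da /is_derive_rowP Dh; apply/is_derive_rowP => j.
rewrite !mxE; under eq_fun do rewrite mxE.
exact: is_derive1_mul.
Qed.

Lemma is_derive1_sub (R : realType) (a b : R -> R) (t da db : R) :
  is_derive t 1 a da -> is_derive t 1 b db ->
  is_derive t 1 (fun s => a s - b s) (da - db).
Proof. by move=> Da Db; exact: (is_deriveB (f := a) (g := b)). Qed.

Lemma is_derive1_add (R : realType) n (h k : R -> 'rV[R]_n) (t : R)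
    (dh dk : 'rV[R]_n) :
  is_derive t 1 h dh -> is_derive t 1 k dk ->
  is_derive t 1 (fun s => h s + k s) (dh + dk).
Proof. by move=> Dh Dk; exact: (is_deriveD (f := h) (g := k)). Qed.

Lemma is_derive1_scalel (R : realType) n (a : R -> R) (c : 'rV[R]_n)
    (t da : R) :
  is_derive t 1 a da -> is_derive t 1 (fun s => a s *: c) (da *: c).
Proof.
move=> Da; have Dc := is_derive_cst c t 1.
by apply: (is_derive_eq (is_derive1_scale Da Dc)); rewrite scaler0 addr0.
Qed.

Lemma is_derive1_scaler (R : realType) n (k : R) (h : R -> 'rV[R]_n)
    (t : R) (dh : 'rV[R]_n) :
  is_derive t 1 h dh -> is_derive t 1 (fun s => k *: h s) (k *: dh).
Proof. by move=> Dh; exact: (is_deriveZ (f := h)). Qed.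

Lemma derivable1_mul (R : realType) (a b : R -> R) (t : R) :
  derivable a t 1 -> derivable b t 1 -> derivable (fun s => a s * b s) t 1.
Proof. exact: derivableM. Qed.

Lemma derivable1_add (R : realType) (a b : R -> R) (t : R) :
  derivable a t 1 -> derivable b t 1 -> derivable (fun s => a s + b s) t 1.
Proof. exact: derivableD. Qed.

Lemma derivable1_sub (R : realType) (a b : R -> R) (t : R) :
  derivable a t 1 -> derivable b t 1 -> derivable (fun s => a s - b s) t 1.
Proof. exact: derivableB. Qed.

Lemma derivable1_inv (R : realType) (a : R -> R) (t : R) :
  derivable a t 1 -> a t != 0 -> derivable (fun s => (a s)^-1) t 1.
Proof. by move=> Da a0; exact: derivableV. Qed.

Lemma derivable1_scale (R : realType) n (a : R -> R) (h : R -> 'rV[R]_n)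
    (t : R) :
  derivable a t 1 -> derivable h t 1 -> derivable (fun s => a s *: h s) t 1.
Proof.
by move=> /derivableP Da /derivableP Dh; case: (is_derive1_scale Da Dh).
Qed.

Lemma derivable1_subv (R : realType) n (h k : R -> 'rV[R]_n) (t : R) :
  derivable h t 1 -> derivable k t 1 -> derivable (fun s => h s - k s) t 1.
Proof. exact: derivableB. Qed.

Lemma smooth_on_derive1 (R : realType) (V : normedModType R) (A : set R)
    (h : R -> V) : smooth_on A h -> smooth_on A (derive1 h).
Proof.
move=> [U [oU AU dU]]; exists U; split=> // n t Ut.
by rewrite -derive1Sn; exact: dU.
Qed.

Lemma smooth_on_near (R : realType) (V : normedModType R) (A : set R)
    (h : R -> V) (t : R) : smooth_on A h -> A t ->
  \forall s \near t, is_derive (s : R) 1 h (derive1 h s).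
Proof.
move=> [U [oU AU dU]] At; have Unear : \near t, U t.
  exact/open_nbhs_nbhs/(conj oU)/AU.
move: Unear; apply: filterS => s Us.
by apply: derivable_is_derive1; exact: (dU 0%N).
Qed.

Lemma smooth_on_is_derive (R : realType) (V : normedModType R) (A : set R)
    (h : R -> V) (t : R) : smooth_on A h -> A t ->
  is_derive t 1 h (derive1 h t).
Proof. by move=> hs At; exact: nbhs_singleton (smooth_on_near hs At). Qed.

(** * Constancy on intervals *)

(** At an endpoint of [I] the function is constant on one side only; the
one-sided difference quotient still determines the two-sided derivative, which
is assumed to exist.  This is what makes relations such as [<l, l'> = 0] hold
at the endpoints of the parameter interval too. *)
Lemma derive_of_constant_on_interval (R : realType) (I : set R) (h : R -> R)
    (c t d : R) :
  nondegenerate_interval I -> (forall s, I s -> h s = c) -> I t ->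
  is_derive t 1 h d -> d = 0.
Proof.
move=> [Iitv [a [b [Ia Ib ab]]]] hc It [dh <-].
have dhc : (fun s => s^-1 *: (h (s *: 1 + t) - h t)) @ 0^' --> 'D_1 h t.
  exact: dh.
have [tb|bt] := ltP t b.
- apply: (@cvg_unique _ (@Rhausdorff R) _ _ _ _ (cvg_dnbhs_at_right dhc)).
  apply: (@cvg_trans _ (cst 0 @ 0^'+)); last exact: cvg_cst.
  apply: near_eq_cvg; near=> s => /=.
  rewrite /cst !hc ?subrr ?scaler0 //.
  apply: (Iitv t b) => //; rewrite [s *: 1]mulr1 ler_wpDl //=.
  by rewrite -lerBrDr; near: s; apply: nbhs_right_le; rewrite subr_gt0.
- have at' : a < t by exact: lt_le_trans bt.
  apply: (@cvg_unique _ (@Rhausdorff R) _ _ _ _ (cvg_dnbhs_at_left dhc)).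
  apply: (@cvg_trans _ (cst 0 @ 0^'-)); last exact: cvg_cst.
  apply: near_eq_cvg; near=> s => /=.
  rewrite /cst !hc ?subrr ?scaler0 //.
  apply: (Iitv a t) => //; rewrite [s *: 1]mulr1; apply/andP; split.
    by rewrite -lerBlDr; near: s; apply: nbhs_left_ge; rewrite subr_lt0.
  by rewrite gerDr.
Unshelve. all: by end_near. Qed.

(** By the mean value theorem: it looks at the derivative inside the interval
and at continuity up to its ends. *)
Lemma constant_of_derive0_on_interval (R : realType) (I : set R)
    (h dh : R -> R) :
  is_interval I -> (forall t, I t -> is_derive t 1 h (dh t)) ->
  (forall t, (\near t, I t) -> dh t = 0) ->
  forall a b, I a -> I b -> h a = h b.
Proof.
move=> Iitv Dh dh0.
suff H a b : I a -> I b -> a < b -> h a = h b.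
  move=> a b Ia Ib; have [ab|ba|->//] := ltgtP a b; first exact: H.
  by rewrite (H b a).
move=> Ia Ib ab.
have Iab t : t \in `[a, b]%R -> I t.
  by rewrite in_itv /= => tab; apply: (Iitv a b).
have [c cab /eqP] : exists2 c, c \in `]a, b[%R & h b - h a = dh c * (b - a).
  apply: MVT => // [t tab|].
    by apply: Dh; apply: Iab; exact: subset_itv_oo_cc tab.
  apply: derivable_within_continuous => t tab.
  by have [] := Dh _ (Iab _ tab).
rewrite dh0 ?mul0r ?subr_eq0 => [/eqP //|].
near=> t; apply: Iab; apply: subset_itv_oo_cc; near: t.
exact: near_in_itvoo.
Unshelve. all: by end_near. Qed.

Lemma constant_on_rectangle (R : realType) (I J : set R) (F : R -> R -> R)
    (Fu Fv : R -> R -> R) :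
  is_interval I -> is_interval J ->
  (forall u v, I u -> J v -> is_derive u 1 (F ^~ v) (Fu u v)) ->
  (forall u v, I u -> J v -> is_derive v 1 (F u) (Fv u v)) ->
  (forall u v, (\near u, I u) -> J v -> Fu u v = 0) ->
  (forall u v, I u -> (\near v, J v) -> Fv u v = 0) ->
  forall u v u' v', I u -> J v -> I u' -> J v' -> F u v = F u' v'.
Proof.
move=> Iitv Jitv DFu DFv Fu0 Fv0 u v u' v' Iu Jv Iu' Jv'.
transitivity (F u' v).
  apply: (constant_of_derive0_on_interval
    (h := F ^~ v) (dh := Fu ^~ v) Iitv) => //.
    by move=> t It; exact: DFu.
  by move=> t It; exact: Fu0.
apply: (constant_of_derive0_on_interval (h := F u') (dh := Fv u') Jitv) => //.
  by move=> t It; exact: DFv.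
by move=> t It; exact: Fv0.
Qed.

(** * Linear algebra of the Minkowski product *)

Lemma rowDE (R : realType) n (x y : 'rV[R]_n) j :
  (x + y) 0 j = x 0 j + y 0 j.
Proof. by rewrite mxE. Qed.

Lemma rowNE (R : realType) n (x : 'rV[R]_n) j : (- x) 0 j = - x 0 j.
Proof. by rewrite mxE. Qed.

Lemma rowZE (R : realType) n (a : R) (x : 'rV[R]_n) j :
  (a *: x) 0 j = a * x 0 j.
Proof. by rewrite mxE. Qed.

Definition rowvE := (rowDE, rowNE, rowZE).

Lemma row4P (R : realType) (x y : 'rV[R]_4) :
  x 0 0 = y 0 0 -> x 0 1 = y 0 1 -> x 0 2 = y 0 2 -> x 0 3 = y 0 3 -> x = y.
Proof.
move=> h0 h1 h2 h3; apply/rowP.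
case; case; last case; last case; last case => //.
- by move=> p; rewrite (_ : Ordinal p = 0) //; apply/val_inj.
- by move=> p; rewrite (_ : Ordinal p = 1) //; apply/val_inj.
- by move=> p; rewrite (_ : Ordinal p = 2) //; apply/val_inj.
- by move=> p; rewrite (_ : Ordinal p = 3) //; apply/val_inj.
Qed.

Lemma minkC (R : realType) (x y : 'rV[R]_4) : mink x y = mink y x.
Proof. by rewrite /mink; ring. Qed.

Lemma minkDl (R : realType) (x y w : 'rV[R]_4) :
  mink (x + y) w = mink x w + mink y w.
Proof. by rewrite /mink !mxE; ring. Qed.

Lemma minkZl (R : realType) (a : R) (x w : 'rV[R]_4) :
  mink (a *: x) w = a * mink x w.
Proof. by rewrite /mink !mxE; ring. Qed.

Lemma minkNl (R : realType) (x w : 'rV[R]_4) : mink (- x) w = - mink x w.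
Proof. by rewrite /mink !mxE; ring. Qed.

Lemma mink0l (R : realType) (w : 'rV[R]_4) : mink 0 w = 0.
Proof. by rewrite /mink !mxE; ring. Qed.

Lemma minkDr (R : realType) (w x y : 'rV[R]_4) :
  mink w (x + y) = mink w x + mink w y.
Proof. by rewrite /mink !mxE; ring. Qed.

Lemma minkZr (R : realType) (a : R) (w x : 'rV[R]_4) :
  mink w (a *: x) = a * mink w x.
Proof. by rewrite /mink !mxE; ring. Qed.

Lemma minkNr (R : realType) (w x : 'rV[R]_4) : mink w (- x) = - mink w x.
Proof. by rewrite /mink !mxE; ring. Qed.

Definition minkE := (minkDl, minkDr, minkNl, minkNr, minkZl, minkZr).

Lemma e1E (R : realType) :
  ((@e1 R 0 0 = 1) * (@e1 R 0 1 = 0) * (@e1 R 0 2 = 0) * (@e1 R 0 3 = 0))%type.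
Proof. by rewrite /e1 !mxE. Qed.

Lemma mink_e1l (R : realType) (x : 'rV[R]_4) : mink e1 x = x 0 0.
Proof. by rewrite /mink !e1E; ring. Qed.

Lemma mink_e1r (R : realType) (x : 'rV[R]_4) : mink x e1 = x 0 0.
Proof. by rewrite minkC mink_e1l. Qed.

Lemma span_e2_e3_e4_coord0 (R : realType) (x : 'rV[R]_4) :
  x \in span_e2_e3_e4 -> x 0 0 = 0.
Proof.
move=> /coord_span ->; rewrite !big_ord_recl big_ord0 !mxE /=.
by rewrite !mulr0 !addr0.
Qed.

(** The Lorentzian cross product of span(e2, e3, e4), as the polynomial
expression in the coordinates that satisfies [<mcross a b, w> = det(a, b, w)]
there.  Having a unit normal of the curve in this form makes its
differentiability immediate. *)
Definition mcross (R : realType) (a b : 'rV[R]_4) : 'rV[R]_4 :=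
  \row_j [:: 0; a 0 2 * b 0 3 - a 0 3 * b 0 2;
             a 0 3 * b 0 1 - a 0 1 * b 0 3;
             a 0 2 * b 0 1 - a 0 1 * b 0 2]`_j.

Lemma mcrossE (R : realType) (a b : 'rV[R]_4) :
  ((mcross a b 0 0 = 0) *
   (mcross a b 0 1 = a 0 2 * b 0 3 - a 0 3 * b 0 2) *
   (mcross a b 0 2 = a 0 3 * b 0 1 - a 0 1 * b 0 3) *
   (mcross a b 0 3 = a 0 2 * b 0 1 - a 0 1 * b 0 2))%type.
Proof. by rewrite /mcross !mxE. Qed.

Lemma mcross_orthl (R : realType) (a b : 'rV[R]_4) : mink (mcross a b) a = 0.
Proof. by rewrite /mink !mcrossE; ring. Qed.

Lemma mcross_orthr (R : realType) (a b : 'rV[R]_4) : mink (mcross a b) b = 0.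
Proof. by rewrite /mink !mcrossE; ring. Qed.

Lemma mink_mcross (R : realType) (a b : 'rV[R]_4) :
  a 0 0 = 0 -> b 0 0 = 0 ->
  mink (mcross a b) (mcross a b) = mink a b ^+ 2 - mink a a * mink b b.
Proof. by move=> a0 b0; rewrite /mink !mcrossE a0 b0; ring. Qed.

(** The decomposition of [w] in the basis [a], [b], [mcross a b], cleared of
its denominator, the Gram determinant of [a] and [b] up to sign. *)
Lemma mcross_expansion (R : realType) (a b w : 'rV[R]_4) :
  a 0 0 = 0 -> b 0 0 = 0 -> w 0 0 = 0 ->
  mink (mcross a b) (mcross a b) *: w =
    mink w (mcross a b) *: mcross a b
    + (mink w b * mink a b - mink w a * mink b b) *: a
    + (mink w a * mink a b - mink w b * mink a a) *: b.
Proof.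
by move=> a0 b0 w0; apply: row4P; rewrite !rowvE /mink !mcrossE a0 b0 w0; ring.
Qed.

Lemma mcross_mcross (R : realType) (a b : 'rV[R]_4) :
  a 0 0 = 0 -> b 0 0 = 0 ->
  mcross a (mcross a b) = mink a a *: b - mink a b *: a.
Proof.
by move=> a0 b0; apply: row4P; rewrite ?rowvE /mink ?mcrossE ?a0 ?b0; ring.
Qed.

Lemma mcrossDr (R : realType) (a b c : 'rV[R]_4) :
  mcross a (b + c) = mcross a b + mcross a c.
Proof. by apply: row4P; rewrite ?rowvE ?mcrossE ?rowvE; ring. Qed.

Lemma mcrossZr (R : realType) (k : R) (a b : 'rV[R]_4) :
  mcross a (k *: b) = k *: mcross a b.
Proof. by apply: row4P; rewrite ?rowvE ?mcrossE ?rowvE; ring. Qed.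

Lemma mcrossxx (R : realType) (a : 'rV[R]_4) : mcross a a = 0.
Proof. by apply: row4P; rewrite [RHS]mxE !mcrossE; ring. Qed.

(** The product is nondegenerate, so [<., m>] is a nonzero linear form, and its
kernel has dimension 3 by the rank theorem. *)
Lemma mink_kernel_is_hyperplane (R : realType) (m : 'rV[R]_4) (p : 'rV[R]_4) :
  m != 0 -> is_hyperplane [set x | mink x m = mink p m].
Proof.
move=> m0.
pose phi (x : 'rV[R]_4) : R^o := mink x m.
have phi_lin : linear phi.
  by move=> a x y; rewrite /phi !minkE.
pose phiL : {linear 'rV[R]_4 -> R^o} :=
  HB.pack phi (GRing.isLinear.Build _ _ _ _ phi phi_lin).
pose W := lker (linfun phiL).
have WE x : (x \in W) = (mink x m == 0) by rewrite memv_ker lfunE.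
exists p, W; split.
- have := limg_ker_dim (linfun phiL) fullv.
  rewrite capfv dimvf /dim /= => dimE.
  suff d1 : \dim (limg (linfun phiL)) = 1%N.
    by move: dimE; rewrite d1 addn1 => -[].
  apply/eqP; rewrite eqn_leq; apply/andP; split.
    by have := dimvS (subvf (limg (linfun phiL))); rewrite dimvf.
  rewrite lt0n; apply: contra m0; rewrite dimv_eq0 => /eqP im0.
  have phi0 x : mink x m = 0.
    have : linfun phiL x \in limg (linfun phiL) by rewrite memv_img ?memvf.
    by rewrite im0 memv0 lfunE => /eqP.
  apply/eqP; apply: row4P; rewrite [RHS]mxE.
  - by rewrite -mink_e1l phi0.
  - by have := phi0 e2; rewrite /mink /e2 !mxE /=; lra.
  - by have := phi0 e3; rewrite /mink /e3 !mxE /=; lra.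
  - by have := phi0 e4; rewrite /mink /e4 !mxE /=; lra.
- apply/seteqP; split => x /=.
    move=> xm; exists (x - p); last by rewrite addrC subrK.
    by rewrite /= WE !minkE xm subrr.
  by move=> [w /=]; rewrite WE => /eqP w0 <-; rewrite !minkE w0 addr0.
Qed.

Lemma mink0r (R : realType) (w : 'rV[R]_4) : mink w 0 = 0.
Proof. by rewrite minkC mink0l. Qed.

(** * Differentiating products of curves in Minkowski space *)

Lemma is_derive1_mink (R : realType) (h k : R -> 'rV[R]_4) (t : R)
    (dh dk : 'rV[R]_4) :
  is_derive t 1 h dh -> is_derive t 1 k dk ->
  is_derive t 1 (fun s => mink (h s) (k s)) (mink dh (k t) + mink (h t) dk).
Proof.
move=> /is_derive_rowP Dh /is_derive_rowP Dk.
have D j := is_derive1_mul (Dh j) (Dk j).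
pose p j s := h s 0 j * k s 0 j.
have ? : is_derive t 1 (p 0) _ := D 0.
have ? : is_derive t 1 (p 1) _ := D 1.
have ? : is_derive t 1 (p 2) _ := D 2.
have ? : is_derive t 1 (p 3) _ := D 3.
apply: (is_derive_eq (f := p 0 + p 1 + p 2 - p 3)).
by rewrite /mink; ring.
Qed.

Lemma is_derive1_mcross (R : realType) (h k : R -> 'rV[R]_4) (t : R)
    (dh dk : 'rV[R]_4) :
  is_derive t 1 h dh -> is_derive t 1 k dk ->
  is_derive t 1 (fun s => mcross (h s) (k s))
    (mcross dh (k t) + mcross (h t) dk).
Proof.
move=> /is_derive_rowP Dh /is_derive_rowP Dk; apply/is_derive_rowP.
have D i j := is_derive1_mul (Dh i) (Dk j).
have DB i j i' j' := is_derive1_sub (D i j) (D i' j').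
have P j : j \in [:: 0; 1; 2; 3 : 'I_4].
  by case: j => -[|[|[|[|]]]].
move=> j; have := P j; rewrite !inE => /or4P[] /eqP ->;
  rewrite mxE !mcrossE; under eq_fun do rewrite mcrossE.
- by rewrite addr0; exact: is_derive_cst.
- by apply: (is_derive_eq (DB 2 3 3 2)); ring.
- by apply: (is_derive_eq (DB 3 1 1 3)); ring.
- by apply: (is_derive_eq (DB 2 1 1 2)); ring.
Qed.

(** * Tangent and normal vectors of a surface *)

Lemma mink_comb (R : realType) (a b : R) (p q w : 'rV[R]_4) :
  mink (a *: p + b *: q) w = a * mink p w + b * mink q w.
Proof. by rewrite !minkE. Qed.

(** A tangent vector that is also normal vanishes, since the coordinate
directions are orthogonal and not lightlike. *)
Lemma orthogonal_to_itself_eq0 (R : realType) (p q : 'rV[R]_4) (a b : R) :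
  mink p q = 0 -> mink p p != 0 -> mink q q != 0 ->
  mink (a *: p + b *: q) p = 0 -> mink (a *: p + b *: q) q = 0 ->
  a *: p + b *: q = 0.
Proof.
move=> pq pp qq; rewrite !mink_comb (minkC q p) pq !mulr0 addr0 add0r.
move=> /eqP; rewrite mulf_eq0 (negbTE pp) orbF => /eqP ->.
move=> /eqP; rewrite mulf_eq0 (negbTE qq) orbF => /eqP ->.
by rewrite !scale0r addr0.
Qed.

Lemma orthogonal_projection (R : realType) (p q w : 'rV[R]_4) :
  mink p q = 0 -> mink p p != 0 -> mink q q != 0 ->
  let t := (mink w p / mink p p) *: p + (mink w q / mink q q) *: q in
  mink (w - t) p = 0 /\ mink (w - t) q = 0.
Proof.
move=> pq pp qq t; rewrite !minkDl !minkNl !mink_comb (minkC q p) pq.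
by rewrite !divfK // !mulr0 addr0 add0r !subrr.
Qed.

Lemma is_normalP (R : realType) (z : R -> R -> 'rV[R]_4) (u v : R)
    (w : 'rV[R]_4) :
  is_normal z u v w <-> mink w (d_u z u v) = 0 /\ mink w (d_v z u v) = 0.
Proof.
rewrite /is_normal /tangent_vector /flat_cov.
move: (d_u z u v) (d_v z u v) => p q; split=> [wn|[wp wq] X].
  have := wn (1, 0); have := wn (0, 1).
  by rewrite /= !scale1r !scale0r addr0 add0r.
by rewrite minkC mink_comb !(minkC _ w) wp wq !mulr0 addr0.
Qed.

Lemma is_normalD (R : realType) (z : R -> R -> 'rV[R]_4) (u v : R)
    (w w' : 'rV[R]_4) :
  is_normal z u v w -> is_normal z u v w' -> is_normal z u v (w + w').
Proof. by move=> nw nw' X; rewrite minkDl nw nw' addr0. Qed.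

Lemma is_normalN (R : realType) (z : R -> R -> 'rV[R]_4) (u v : R)
    (w : 'rV[R]_4) :
  is_normal z u v w -> is_normal z u v (- w).
Proof. by move=> nw X; rewrite minkNl nw oppr0. Qed.

Lemma is_normalZ (R : realType) (z : R -> R -> 'rV[R]_4) (u v a : R)
    (w : 'rV[R]_4) :
  is_normal z u v w -> is_normal z u v (a *: w).
Proof. by move=> nw X; rewrite minkZl nw mulr0. Qed.

Lemma mink_normal_tangent (R : realType) (z : R -> R -> 'rV[R]_4) (u v : R)
    (w n : 'rV[R]_4) :
  is_normal z u v n -> is_tangent z u v w -> mink w n = 0.
Proof. by move=> nn [X ->]; rewrite minkC; exact: nn. Qed.

Lemma is_tangentB (R : realType) (z : R -> R -> 'rV[R]_4) (u v : R)
    (w w' : 'rV[R]_4) :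
  is_tangent z u v w -> is_tangent z u v w' -> is_tangent z u v (w - w').
Proof.
move=> [X ->] [Y ->]; exists (X.1 - Y.1, X.2 - Y.2).
rewrite /tangent_vector /flat_cov; move: (d_u z u v) (d_v z u v) => p q /=.
by rewrite !scalerBl opprD addrACA.
Qed.

Definition orthogonal_net (R : realType) (z : R -> R -> 'rV[R]_4) (u v : R) :=
  [/\ mink (d_u z u v) (d_v z u v) = 0, mink (d_u z u v) (d_u z u v) != 0 &
      mink (d_v z u v) (d_v z u v) != 0].

Lemma normal_part_eq (R : realType) (z : R -> R -> 'rV[R]_4) (u v : R)
    (w n : 'rV[R]_4) :
  orthogonal_net z u v ->
  is_normal z u v n -> is_tangent z u v (w - n) -> normal_part z u v w = n.
Proof.
move=> [zo zu0 zv0] nn nt; apply: xget_unique => // m [mn mt].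
have [X E] : is_tangent z u v (m - n).
  rewrite (_ : m - n = (w - n) - (w - m)); first exact: is_tangentB.
  by apply/rowP => j; rewrite !rowvE; ring.
have [mu mv] := (is_normalP _ _ _ _).1 mn.
have [nu nv] := (is_normalP _ _ _ _).1 nn.
apply/eqP; rewrite -subr_eq0 E; apply/eqP.
move: E zo zu0 zv0 mu mv nu nv; rewrite /tangent_vector /flat_cov.
move: (d_u z u v) (d_v z u v) => p q E pq pp qq mp mq np nq.
by apply: orthogonal_to_itself_eq0 => //; 
  rewrite -E minkDl minkNl ?mp ?mq ?np ?nq subrr.
Qed.

(** The tangential part is the explicit orthogonal projection, so the
decomposition into tangential and normal parts exists and the default value
in the definition of [normal_part] does not occur. *)
Lemma normal_part0_tangent (R : realType) (z : R -> R -> 'rV[R]_4) (u v : R)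
    (w : 'rV[R]_4) :
  orthogonal_net z u v -> normal_part z u v w = 0 -> is_tangent z u v w.
Proof.
move=> zo.
pose X := (mink w (d_u z u v) / mink (d_u z u v) (d_u z u v),
           mink w (d_v z u v) / mink (d_v z u v) (d_v z u v)).
have wE : w - (w - tangent_vector z X u v) = tangent_vector z X u v.
  by rewrite opprB addrC subrK.
rewrite (normal_part_eq (n := w - tangent_vector z X u v)) //.
- by move=> n0; exists X; rewrite -wE n0 subr0.
- by apply/is_normalP; case: zo => *; exact: orthogonal_projection.
- by exists X.
Qed.

(** * The mean curvature vector in an orthogonal net *)

(** If [M] has rows [(a, b)], [(c, d)] and [S = diag(1, -1)], the hypotheses say
[M diag(E, G) M^T = S]; hence [M^T S M] is the inverse of [diag(E, G)], and the
conclusion is its upper left entry. *)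
Lemma lorentz_orthonormal_trace (R : realFieldType) (E G a b c d : R) :
  a * a * E + b * b * G = 1 -> c * c * E + d * d * G = -1 ->
  a * c * E + b * d * G = 0 -> a * a - c * c = E^-1.
Proof.
move=> h1 h2 h3.
have D : (a * d - b * c) ^+ 2 * (E * G) = -1.
  transitivity ((a * a * E + b * b * G) * (c * c * E + d * d * G)
                - (a * c * E + b * d * G) ^+ 2); first by ring.
  by rewrite h1 h2 h3; ring.
have : (a * d - b * c) * ((a * a - c * c) * E - 1) = 0.
  (* Eliminate the off-diagonal entry a b - c d of M^T S M. *)
  transitivity (d * (a * (a * a * E + b * b * G - 1)
                     - c * (a * c * E + b * d * G))
                - b * (a * (a * c * E + b * d * G)
                       - c * (c * c * E + d * d * G + 1))); first by ring.
  by rewrite h1 h2 h3; ring.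
have N0 : 0 != -1 :> R by rewrite eq_sym oppr_eq0 oner_eq0.
have D0 : a * d - b * c != 0.
  by apply/eqP => D0; move: D; rewrite D0 expr2 !mul0r => /eqP; exact/negP.
have E0 : E != 0.
  by apply/eqP => E0; move: D; rewrite E0 mul0r mulr0 => /eqP; exact/negP.
move=> /eqP; rewrite mulf_eq0 (negbTE D0) /= subr_eq0 => /eqP tE.
by apply: (mulIf E0); rewrite tE mulVf.
Qed.

Lemma lorentz_orthonormal_exists (R : rcfType) (E G : R) : E * G < 0 ->
  exists a b c d, [/\ a * a * E + b * b * G = 1,
    c * c * E + d * d * G = -1 & a * c * E + b * d * G = 0].
Proof.
have sqrtV (x : R) : 0 < x -> (Num.sqrt x)^-1 * (Num.sqrt x)^-1 * x = 1.
  move=> x0; rewrite -invfM -expr2 sqr_sqrtr ?(ltW x0) // mulVf //.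
  by rewrite gt_eqF.
have [Epos|Eneg|<-] := ltgtP 0 E; last by rewrite mul0r ltxx.
- rewrite pmulr_rlt0 // => Gneg.
  have := sqrtV _ Epos; have := sqrtV (- G); rewrite oppr_gt0 => /(_ Gneg).
  set c := (Num.sqrt _)^-1; set a := (Num.sqrt _)^-1 => hc ha.
  by exists a, 0, 0, c; split; lra.
- rewrite nmulr_rlt0 // => Gpos.
  have := sqrtV _ Gpos; have := sqrtV (- E); rewrite oppr_gt0 => /(_ Eneg).
  set c := (Num.sqrt _)^-1; set a := (Num.sqrt _)^-1 => hc ha.
  by exists 0, a, c, 0; split; lra.
Qed.

(** [2 H] is the trace of the second fundamental form with respect to the metric
and can therefore be computed in the coordinate frame, without normalizing it.
This also shows that [H] is independent of the orthonormal frame. *)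
Lemma mean_curvature_trace (R : realType) (z : R -> R -> 'rV[R]_4) (u v : R)
    (nuu nvv : 'rV[R]_4) :
  mink (d_u z u v) (d_v z u v) = 0 ->
  mink (d_u z u v) (d_u z u v) * mink (d_v z u v) (d_v z u v) < 0 ->
  (forall X, second_fundamental_form z u v X X =
     (X.1 * X.1) *: nuu + (X.2 * X.2) *: nvv) ->
  mean_curvature z u v =
    2^-1 *: ((mink (d_u z u v) (d_u z u v))^-1 *: nuu
             + (mink (d_v z u v) (d_v z u v))^-1 *: nvv).
Proof.
rewrite /mean_curvature /lorentz_frame /tangent_vector /flat_cov.
move: (d_u z u v) (d_v z u v) => p q pq EG0 sE.
set E := mink p p in EG0 *; set G := mink q q in EG0 *.
have gE (X Y : R * R) : mink (X.1 *: p + X.2 *: q) (Y.1 *: p + Y.2 *: q) =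
    X.1 * Y.1 * E + X.2 * Y.2 * G.
  rewrite mink_comb !(minkC _ (Y.1 *: p + _)) !mink_comb (minkC q p) pq.
  by rewrite -/E -/G; ring.
have trE X Y : X.1 * X.1 * E + X.2 * X.2 * G = 1 ->
    Y.1 * Y.1 * E + Y.2 * Y.2 * G = -1 ->
    X.1 * Y.1 * E + X.2 * Y.2 * G = 0 ->
    2^-1 *: (second_fundamental_form z u v X X
             - second_fundamental_form z u v Y Y) =
    2^-1 *: (E^-1 *: nuu + G^-1 *: nvv).
  move=> h1 h2 h3; rewrite !sE.
  rewrite -(lorentz_orthonormal_trace h1 h2 h3).
  rewrite -(@lorentz_orthonormal_trace _ G E X.2 X.1 Y.2 Y.1) //;
    try by rewrite addrC.
  by congr (_ *: _); rewrite !scalerBl opprD addrACA.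
have [a [b [c [d [h1 h2 h3]]]]] := lorentz_orthonormal_exists EG0.
apply: xget_unique => [|h [X [Y [[]]]]]; last first.
  by rewrite !gE => k1 k2 k3 ->; exact: trE.
by exists (a, b), (c, d); rewrite !gE trE.
Qed.

(** * Curves in the unit pseudospheres of span(e2, e3, e4) *)

Definition curve_normal (R : realType) (l : R -> 'rV[R]_4) (v : R) :=
  mcross (l v) (derive1 l v).

Definition geodesic_curvature (R : realType) (l : R -> 'rV[R]_4) (v : R) :=
  mink (derive1 (derive1 l) v) (curve_normal l v).

(** The two target surfaces of [l], the de Sitter sphere for [e = 1] and the
hyperbolic plane for [e = -1], treated together. *)
Definition pseudospherical (R : realType) (e : R) (J : set R)
    (l : R -> 'rV[R]_4) :=
  [/\ e = 1 \/ e = -1, nondegenerate_interval J, smooth_on J l &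
      forall v, J v -> [/\ l v 0 0 = 0, mink (l v) (l v) = e &
        mink (derive1 l v) (derive1 l v) = - e]].

(** Differentiate [l v 0 0 = 0] and [<l, l> = e]. *)
Lemma pseudospherical_velocity (R : realType) (e : R) (J : set R)
    (l : R -> 'rV[R]_4) (v : R) : pseudospherical e J l -> J v ->
  derive1 l v 0 0 = 0 /\ mink (l v) (derive1 l v) = 0.
Proof.
move=> [_ Jitv ls lE] Jv; have Dl := smooth_on_is_derive ls Jv.
split.
  apply: (derive_of_constant_on_interval
    (h := fun s => l s 0 0) (c := 0) Jitv _ Jv).
    by move=> s /lE[].
  by move/is_derive_rowP : Dl; exact.
have /eqP := derive_of_constant_on_interval Jitv
  (fun s Js => let: And3 _ h _ := lE s Js in h) Jv (is_derive1_mink Dl Dl).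
by rewrite minkC -mulr2n mulrn_eq0 /= => /eqP.
Qed.

(** The components of [l''] along [l] and [l'] are found by differentiating
[<l, l'> = 0] and [<l', l'> = - e]; the component along the curve normal is
the geodesic curvature by definition. *)
Lemma pseudospherical_acceleration (R : realType) (e : R) (J : set R)
    (l : R -> 'rV[R]_4) (v : R) : pseudospherical e J l -> J v ->
  derive1 (derive1 l) v = l v + geodesic_curvature l v *: curve_normal l v.
Proof.
move=> lP Jv; have [e1 Jitv ls lE] := lP.
have Dl := smooth_on_is_derive ls Jv.
have Dl' := smooth_on_is_derive (smooth_on_derive1 ls) Jv.
have [l0 ll l'l'] := lE _ Jv; have [l'0 ll'] := pseudospherical_velocity lP Jv.
set w := derive1 (derive1 l) v in Dl' *.
have w0 : w 0 0 = 0.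
  apply: (derive_of_constant_on_interval
    (h := fun s => derive1 l s 0 0) (c := 0) Jitv _ Jv).
    by move=> s Js; case: (pseudospherical_velocity lP Js).
  by move/is_derive_rowP : Dl'; exact.
have wl' : mink w (derive1 l v) = 0.
  have /eqP := derive_of_constant_on_interval Jitv
    (fun s Js => let: And3 _ _ h := lE s Js in h) Jv (is_derive1_mink Dl' Dl').
  by rewrite [X in _ + X]minkC -mulr2n mulrn_eq0 /= => /eqP.
have wl : mink w (l v) = e.
  have /eqP := derive_of_constant_on_interval Jitv
    (fun s Js => (pseudospherical_velocity lP Js).2) Jv
    (is_derive1_mink Dl Dl').
  by rewrite l'l' addrC subr_eq0 minkC => /eqP.
have := mcross_expansion l0 l'0 w0.
rewrite mink_mcross // -/(curve_normal l v).
rewrite -[mink w _]/(geodesic_curvature l v).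
move: (geodesic_curvature l v) (curve_normal l v) => k n.
rewrite ll' ll l'l' wl wl' !mulr0 !mul0r subrr scale0r addr0 sub0r expr2 mul0r.
have ee : e * e = 1 by case: e1 => ->; rewrite ?mulrNN mulr1.
by rewrite mulrN opprK add0r ee !scale1r addrC.
Qed.

Lemma curve_normal_facts (R : realType) (e : R) (J : set R)
    (l : R -> 'rV[R]_4) (v : R) : pseudospherical e J l -> J v ->
  [/\ curve_normal l v 0 0 = 0, mink (curve_normal l v) (curve_normal l v) = 1,
      mink (curve_normal l v) (l v) = 0 &
      mink (curve_normal l v) (derive1 l v) = 0].
Proof.
move=> lP Jv; have [e1 Jitv ls lE] := lP.
have [l0 ll l'l'] := lE _ Jv; have [l'0 ll'] := pseudospherical_velocity lP Jv.
rewrite /curve_normal mcrossE mcross_orthl mcross_orthr mink_mcross //.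
rewrite ll l'l' ll' expr2 mul0r sub0r mulrN opprK.
by split => //; case: e1 => ->; rewrite ?mulrNN mulr1.
Qed.

(** [n' = l' x l' + l x l''], where [l'' = l + kappa n], so only
[kappa (l x n)] remains, and [l x (l x l')] is [e l']. *)
Lemma is_derive_curve_normal (R : realType) (e : R) (J : set R)
    (l : R -> 'rV[R]_4) (v : R) : pseudospherical e J l -> J v ->
  is_derive v 1 (curve_normal l) ((e * geodesic_curvature l v) *: derive1 l v).
Proof.
move=> lP Jv; have [e1 Jitv ls lE] := lP.
have Dl := smooth_on_is_derive ls Jv.
have Dl' := smooth_on_is_derive (smooth_on_derive1 ls) Jv.
have [l0 ll l'l'] := lE _ Jv; have [l'0 ll'] := pseudospherical_velocity lP Jv.
apply: (is_derive_eq (is_derive1_mcross Dl Dl')).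
rewrite (pseudospherical_acceleration lP Jv) mcrossxx add0r mcrossDr mcrossxx.
rewrite add0r mcrossZr mcross_mcross // ll ll' scale0r subr0 scalerA.
by rewrite mulrC.
Qed.

(** * The second fundamental form of a meridian surface *)

Section MeridianSurface.
Context {R : realType}.
Context (e : R) (I J : set R) (f g : R -> R) (l : R -> 'rV[R]_4).
Local Notation z := (meridian_surface f g l).
Local Notation f' := (derive1 f).
Local Notation g' := (derive1 g).
Local Notation f'' := (derive1 (derive1 f)).
Local Notation g'' := (derive1 (derive1 g)).
Local Notation l' := (derive1 l).
Local Notation n := (curve_normal l).
Local Notation kappa := (geodesic_curvature l).

(** [<z_u, z_u>], the squared speed of the meridian curve. *)
Definition meridian_speed (u : R) := e * (f' u * f' u) + g' u * g' u.

(** The last inequality says that [z_u] is spacelike for [e = 1] and timelike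
for [e = -1]; as [<z_v, z_v> = - e f ^ 2], the induced metric is Lorentzian in
both cases. *)
Definition hyperbolic_type :=
  [/\ pseudospherical e J l, nondegenerate_interval I,
      smooth_on I f, smooth_on I g &
      forall u, I u -> 0 < f u /\ 0 < e * meridian_speed u].

(** The normal vector of the surface that lies in the plane of the meridian;
it is not normalized, which avoids square roots. *)
Definition meridian_normal (u v : R) : 'rV[R]_4 :=
  f' u *: e1 - (e * g' u) *: l v.

(** The coefficient of [meridian_normal] in [2 H]: the first term comes from the
curvature of the meridian, that is from [z_uu], the second from [z_vv]. *)
Definition meridian_bending (u : R) : R :=
  e * (f' u * g'' u - g' u * f'' u) / (meridian_speed u * meridian_speed u)
  + g' u / (f u * meridian_speed u).

Definition meridian_curvature_vector (u v : R) : 'rV[R]_4 :=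
  2^-1 *: (meridian_bending u *: meridian_normal u v
           - (e * kappa v / f u) *: n v).

Context (hS : hyperbolic_type).

Let e_cases : e = 1 \/ e = -1.
Proof. by case: hS => -[]. Qed.

Let ee : e * e = 1.
Proof. by case: e_cases => ->; rewrite ?mulrNN mulr1. Qed.

Let e_neq0 : e != 0.
Proof. by case: e_cases => ->; rewrite ?oppr_eq0 oner_neq0. Qed.

Let f_neq0 u : I u -> f u != 0.
Proof. by case: hS => _ _ _ _ h /h [f0 _]; rewrite gt_eqF. Qed.

Let speed_neq0 u : I u -> meridian_speed u != 0.
Proof.
case: hS => _ _ _ _ h /h [_ E0]; apply: contraTneq E0 => ->.
by rewrite mulr0 ltxx.
Qed.

Let smooth_l : smooth_on J l.
Proof. by case: hS => -[]. Qed.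

Let l_facts v : J v -> [/\ l v 0 0 = 0, mink (l v) (l v) = e,
  mink (l' v) (l' v) = - e, l' v 0 0 = 0 & mink (l v) (l' v) = 0].
Proof.
move=> Jv; case: hS => lP _ _ _ _.
have [l'0 ll'] := pseudospherical_velocity lP Jv.
by case: (lP) => _ _ _ /(_ _ Jv) [].
Qed.

Lemma meridian_d_u u v : I u -> d_u z u v = f' u *: l v + g' u *: e1.
Proof.
move=> Iu; case: hS => _ _ fs gs _; apply: is_derive_derive1.
exact: is_derive1_add (is_derive1_scalel _ (smooth_on_is_derive fs Iu))
  (is_derive1_scalel _ (smooth_on_is_derive gs Iu)).
Qed.

(** The formula is also needed at parameters near [J] but outside it, where
the differentiability of [l] still holds. *)
Lemma meridian_d_v_of_derive (u v : R) : is_derive v 1 l (l' v) ->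
  d_v z u v = f u *: l' v.
Proof.
move=> Dl; apply: is_derive_derive1.
have Dc := is_derive_cst (g u *: e1) v 1.
apply: (is_derive_eq (is_derive1_add (is_derive1_scaler (f u) Dl) Dc)).
by rewrite addr0.
Qed.

Lemma meridian_d_v u v : J v -> d_v z u v = f u *: l' v.
Proof.
by move=> Jv; apply: meridian_d_v_of_derive; exact: smooth_on_is_derive Jv.
Qed.

Lemma meridian_first_form u v : I u -> J v ->
  [/\ mink (d_u z u v) (d_v z u v) = 0,
      mink (d_u z u v) (d_u z u v) = meridian_speed u &
      mink (d_v z u v) (d_v z u v) = - e * (f u * f u)].
Proof.
move=> Iu Jv; rewrite meridian_d_u // meridian_d_v //.
have [l0 ll l'l' l'0 ll'] := l_facts Jv.
rewrite /meridian_speed.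
move: (l v) (l' v) l0 ll l'l' l'0 ll' => x y x0 xx yy y0 xy.
rewrite !minkE !mink_e1l !mink_e1r x0 y0 xx yy xy !e1E.
by split; ring.
Qed.

Lemma meridian_orthogonal_net u v : I u -> J v -> orthogonal_net z u v.
Proof.
move=> Iu Jv; rewrite /orthogonal_net.
have [uv uu vv] := meridian_first_form Iu Jv; split; first exact: uv.
  by rewrite [X in X != _]uu speed_neq0.
by rewrite [X in X != _]vv !mulf_neq0 ?oppr_eq0 ?f_neq0.
Qed.

Lemma meridian_is_normal u v w : I u -> J v ->
  mink w (f' u *: l v + g' u *: e1) = 0 -> mink w (l' v) = 0 ->
  is_normal z u v w.
Proof.
move=> Iu Jv wu wv; apply/is_normalP; rewrite meridian_d_u // meridian_d_v //.
by rewrite wu minkZr wv mulr0.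
Qed.

Lemma meridian_normal_is_normal u v : I u -> J v ->
  is_normal z u v (meridian_normal u v).
Proof.
move=> Iu Jv; have [l0 ll l'l' l'0 ll'] := l_facts Jv.
rewrite /meridian_normal; apply: meridian_is_normal => //.
  rewrite !minkE !mink_e1l !mink_e1r l0 ll !e1E.
  by ring: ee.
by rewrite !minkE mink_e1l l'0 ll'; ring.
Qed.

Lemma curve_normal_is_normal u v : I u -> J v -> is_normal z u v (n v).
Proof.
move=> Iu Jv; case: hS => lP _ _ _ _.
have [n0 nn nl nl'] := curve_normal_facts lP Jv.
apply: meridian_is_normal => //.
by rewrite !minkE nl mink_e1r n0; ring.
Qed.

(** The second derivatives [z_uu], [z_uv], [z_vv] combined with the constant
components of [X] and [Y].  The formulas for the first derivatives hold in a
whole neighbourhood of the point, so they may be differentiated. *)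
Lemma flat_cov_tangent_vector u v X Y : I u -> J v ->
  flat_cov X (tangent_vector z Y) u v =
    (X.1 * Y.1) *: (f'' u *: l v + g'' u *: e1)
    + (X.1 * Y.2 + X.2 * Y.1) *: (f' u *: l' v)
    + (X.2 * Y.2) *: (f u *: derive1 l' v).
Proof.
move=> Iu Jv; case: hS => _ _ fs gs _.
have Dl := smooth_on_is_derive smooth_l Jv.
have Dl' := smooth_on_is_derive (smooth_on_derive1 smooth_l) Jv.
have Du : d_u (tangent_vector z Y) u v =
    Y.1 *: (f'' u *: l v + g'' u *: e1) + Y.2 *: (f' u *: l' v).
  apply: is_derive_derive1.
  apply: (near_eq_is_derive (f := fun s =>
    Y.1 *: (f' s *: l v + g' s *: e1) + Y.2 *: (f s *: l' v))).
    near=> s; rewrite /tangent_vector /flat_cov.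
    congr (_ *: _ + _ *: _); symmetry; last exact: meridian_d_v.
    apply: is_derive_derive1.
    apply: is_derive1_add; apply: is_derive1_scalel.
      by near: s; exact: smooth_on_near fs Iu.
    by near: s; exact: smooth_on_near gs Iu.
  apply: is_derive1_add; apply: is_derive1_scaler.
    by apply: is_derive1_add; apply: is_derive1_scalel;
      apply: smooth_on_is_derive Iu; exact: smooth_on_derive1.
  by apply: is_derive1_scalel; exact: smooth_on_is_derive Iu.
have Dv : d_v (tangent_vector z Y) u v =
    Y.1 *: (f' u *: l' v) + Y.2 *: (f u *: derive1 l' v).
  apply: is_derive_derive1.
  apply: (near_eq_is_derive (f := fun s =>
    Y.1 *: (f' u *: l s + g' u *: e1) + Y.2 *: (f u *: l' s))).
    near=> s; rewrite /tangent_vector /flat_cov.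
    congr (_ *: _ + _ *: _); symmetry; first exact: meridian_d_u.
    apply: meridian_d_v_of_derive.
    by near: s; exact: smooth_on_near smooth_l Jv.
  apply: is_derive1_add; apply: is_derive1_scaler.
  have Dc := is_derive_cst (g' u *: @e1 R) v 1.
  apply: (is_derive_eq (is_derive1_add (is_derive1_scaler (f' u) Dl) Dc)).
  by rewrite addr0.
rewrite /flat_cov Du Dv.
move: (f'' u *: l v + _) (f' u *: l' v) (f u *: derive1 l' v) => a b c.
by apply/rowP => j; rewrite !rowvE; ring.
Unshelve. all: by end_near. Qed.

(** There is no mixed term: [z_uv = f' l'] is tangent. *)
Lemma meridian_second_form u v X Y : I u -> J v ->
  second_fundamental_form z u v X Y =
    (X.1 * Y.1) *: ((e * (f' u * g'' u - g' u * f'' u) / meridian_speed u)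
                      *: meridian_normal u v)
    + (X.2 * Y.2) *: (f u *: (kappa v *: n v
        - (e * g' u / meridian_speed u) *: meridian_normal u v)).
Proof.
move=> Iu Jv; rewrite /second_fundamental_form flat_cov_tangent_vector //.
have lP : pseudospherical e J l by case: hS.
rewrite (pseudospherical_acceleration lP Jv).
apply: normal_part_eq; first exact: meridian_orthogonal_net.
  have mn := meridian_normal_is_normal Iu Jv.
  have cn := curve_normal_is_normal Iu Jv.
  apply: is_normalD; do 2 apply: is_normalZ => //.
  by apply: is_normalD; [|apply: is_normalN]; exact: is_normalZ.
have [E0 f0] := (speed_neq0 Iu, f_neq0 Iu).
(* With E = meridian_speed, c = f' g'' - g' f'' and nu = meridian_normal,
   E (f'' l + g'' e1) = e c nu + (e f' f'' + g' g'') z_u and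
   E l = - e g' nu + e f' z_u; the first gives the normal part of z_uu, the
   second that of the term f l in z_vv. *)
exists ((X.1 * Y.1 * (e * f' u * f'' u + g' u * g'' u)
         + X.2 * Y.2 * (e * f u * f' u)) / meridian_speed u,
        (X.1 * Y.2 + X.2 * Y.1) * f' u / f u).
rewrite /tangent_vector /flat_cov meridian_d_u // meridian_d_v //=.
have EE : meridian_speed u = e * (f' u * f' u) + g' u * g' u by [].
rewrite /meridian_normal.
move: (l v) (l' v) (kappa v) (n v) E0 EE => x y k m; move: (meridian_speed u).
move: (f'' u) (g'' u) (f' u) (g' u) (f u) f0 X Y.
move=> ddf ddg df dg r r0 [X1 X2] [Y1 Y2] E E0 EE /=.
apply/rowP => j; rewrite !rowvE.
by field: EE ee; rewrite ?E0 ?r0.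
Qed.

(** The trace of the second fundamental form for the diagonal metric
[diag(meridian_speed, - e f ^ 2)]. *)
Lemma meridian_mean_curvature u v : I u -> J v ->
  mean_curvature z u v = meridian_curvature_vector u v.
Proof.
move=> Iu Jv; have [zo zu zv] := meridian_first_form Iu Jv.
have [E0 f0] := (speed_neq0 Iu, f_neq0 Iu).
rewrite (mean_curvature_trace zo _ (fun X => meridian_second_form X X Iu Jv)).
  rewrite [X in X^-1 *: _ + _]zu [X in _ + X^-1 *: _]zv.
  rewrite /meridian_curvature_vector /meridian_bending; congr (_ *: _).
  move: (n v) (kappa v) (meridian_normal u v) (meridian_speed u) E0.
  move: (f'' u) (g'' u) (f' u) (g' u) (f u) f0.
  move=> ddf ddg df dg r r0 m k w E E0; have e0 := e_neq0.
  by apply/rowP => j; rewrite !rowvE; field: ee; rewrite ?r0 ?E0 ?oppr_eq0 ?e0.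
rewrite [X in X * _]zu [X in _ * X]zv mulNr mulrN mulrCA mulrA oppr_lt0.
rewrite mulr_gt0 //.
  by case: hS => _ _ _ _ /(_ u Iu) [].
by case: hS => _ _ _ _ /(_ u Iu) [fu _]; rewrite mulr_gt0.
Qed.

(** * Consequences of a parallel mean curvature vector *)

Local Notation H := meridian_curvature_vector.

Lemma is_derive_curvature_vector_u u v : I u ->
  is_derive u 1 (H ^~ v) (d_u H u v).
Proof.
move=> Iu; apply: derivable_is_derive1; case: hS => _ _ fs gs _.
have Df : derivable f u 1 by case: (smooth_on_is_derive fs Iu).
have fs' := smooth_on_derive1 fs; have gs' := smooth_on_derive1 gs.
have Df' : derivable f' u 1 by case: (smooth_on_is_derive fs' Iu).
have Dg' : derivable g' u 1 by case: (smooth_on_is_derive gs' Iu).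
have Df'' : derivable f'' u 1.
  by case: (smooth_on_is_derive (smooth_on_derive1 fs') Iu).
have Dg'' : derivable g'' u 1.
  by case: (smooth_on_is_derive (smooth_on_derive1 gs') Iu).
have [E0 f0] := (speed_neq0 Iu, f_neq0 Iu).
move: E0 Df' Dg' Df'' Dg''; rewrite /meridian_curvature_vector.
rewrite /meridian_bending /meridian_normal /meridian_speed.
move: (l v) (n v) (kappa v) (f') (g') (f'') (g'').
move=> x m k df dg ddf ddg E0 Df' Dg' Df'' Dg''.
have Dc (c : R) := derivable_cst c u (1 : R).
have Dcv (c : 'rV[R]_4) := derivable_cst c u (1 : R).
have DE := derivable1_add (derivable1_mul (Dc e) (derivable1_mul Df' Df'))
  (derivable1_mul Dg' Dg').
have DK := derivable1_mul (Dc e)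
  (derivable1_sub (derivable1_mul Df' Dg'') (derivable1_mul Dg' Df'')).
have DA := derivable1_add
  (derivable1_mul DK (derivable1_inv (derivable1_mul DE DE) (mulf_neq0 E0 E0)))
  (derivable1_mul Dg'
    (derivable1_inv (derivable1_mul Df DE) (mulf_neq0 f0 E0))).
have Dnu := derivable1_subv (derivable1_scale Df' (Dcv e1))
  (derivable1_scale (derivable1_mul (Dc e) Dg') (Dcv x)).
have Dn := derivable1_scale (derivable1_mul (Dc (e * k)) (derivable1_inv Df f0))
  (Dcv m).
exact: (derivable1_scale (Dc _) (derivable1_subv (derivable1_scale DA Dnu) Dn)).
Qed.

Lemma is_derive_curvature_vector_v u v : J v ->
  is_derive v 1 (H u) (d_v H u v).
Proof.
move=> Jv; apply: derivable_is_derive1; case: hS => lP _ _ _ _.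
have Dl : derivable l v 1 by case: (smooth_on_is_derive smooth_l Jv).
have Dn : derivable n v 1 by case: (is_derive_curve_normal lP Jv).
have Dl'' := smooth_on_is_derive
  (smooth_on_derive1 (smooth_on_derive1 smooth_l)) Jv.
have Dk : derivable kappa v 1.
  by case: (is_derive1_mink Dl'' (is_derive_curve_normal lP Jv)).
move: Dl Dn Dk; rewrite /meridian_curvature_vector /meridian_normal.
move: (meridian_bending u) (f' u) (g' u) (f u) => A df dg r.
move: (n) (kappa) => m k Dl Dn Dk; move: (e1) => w.
have Dc (c : R) := derivable_cst c v (1 : R).
have Dcv (c : 'rV[R]_4) := derivable_cst c v (1 : R).
have Dnu := derivable1_subv (Dcv (df *: w)) (derivable1_scale (Dc (e * dg)) Dl).
have Dkn := derivable1_scale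
  (derivable1_mul (derivable1_mul (Dc e) Dk) (Dc r^-1)) Dn.
exact: (derivable1_scale (Dc _)
  (derivable1_subv (derivable1_scale (Dc A) Dnu) Dkn)).
Qed.

Lemma curvature_vector_is_normal u v : I u -> J v -> is_normal z u v (H u v).
Proof.
move=> Iu Jv; apply: is_normalZ; apply: is_normalD; last apply: is_normalN.
  exact/is_normalZ/meridian_normal_is_normal.
exact/is_normalZ/curve_normal_is_normal.
Qed.

Context (hP : parallel_mean_curvature I J z).

(** At an interior parameter [mean_curvature] agrees with the explicit formula
in a neighbourhood, so the two have the same derivative. *)
Lemma parallel_d_u_tangent u v : (\near u, I u) -> J v ->
  is_tangent z u v (d_u H u v).
Proof.
move=> nIu Jv; have Iu := nbhs_singleton nIu.
apply: normal_part0_tangent; first exact: meridian_orthogonal_net.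
have := hP Iu Jv (1, 0); rewrite /normal_cov /flat_cov /= scale1r scale0r addr0.
suff -> : d_u (mean_curvature z) u v = d_u H u v by [].
rewrite /d_u !derive1E; apply: near_eq_derive.
by apply: filterS nIu => s Is; exact: meridian_mean_curvature.
Qed.

Lemma parallel_d_v_tangent u v : I u -> (\near v, J v) ->
  is_tangent z u v (d_v H u v).
Proof.
move=> Iu nJv; have Jv := nbhs_singleton nJv.
apply: normal_part0_tangent; first exact: meridian_orthogonal_net.
have := hP Iu Jv (0, 1); rewrite /normal_cov /flat_cov /= scale1r scale0r add0r.
suff -> : d_v (mean_curvature z) u v = d_v H u v by [].
rewrite /d_v !derive1E; apply: near_eq_derive.
by apply: filterS nJv => s Js; exact: meridian_mean_curvature.
Qed.

Lemma parallel_norm_constant u v u' v' : I u -> J v -> I u' -> J v' ->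
  mink (H u v) (H u v) = mink (H u' v') (H u' v').
Proof.
case: (hS) => -[_ [Jitv _] _ _] [Iitv _] _ _ _.
apply: (@constant_on_rectangle R I J (fun u v => mink (H u v) (H u v))
  (fun u v => mink (d_u H u v) (H u v) + mink (H u v) (d_u H u v))
  (fun u v => mink (d_v H u v) (H u v) + mink (H u v) (d_v H u v)) Iitv Jitv);
  move=> {u v u' v'} u v Iu Jv.
- have D := is_derive_curvature_vector_u v Iu; exact: (is_derive1_mink D D).
- have D := is_derive_curvature_vector_v u Jv; exact: (is_derive1_mink D D).
- rewrite [X in _ + X]minkC.
  rewrite (mink_normal_tangent _ (parallel_d_u_tangent Iu Jv)) ?addr0 //.
  by apply: curvature_vector_is_normal => //; exact: nbhs_singleton Iu.
- rewrite [X in _ + X]minkC.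
  rewrite (mink_normal_tangent _ (parallel_d_v_tangent Iu Jv)) ?addr0 //.
  by apply: curvature_vector_is_normal => //; exact: nbhs_singleton Jv.
Qed.

Lemma curvature_vector_curve_normal u v : J v ->
  mink (H u v) (n v) = - (2^-1 * (e * kappa v / f u)).
Proof.
move=> Jv; case: hS => lP _ _ _ _.
have [n0 nn nl _] := curve_normal_facts lP Jv.
rewrite /meridian_curvature_vector /meridian_normal.
move: (n v) (l v) n0 nn nl => m x m0 mm mx.
by rewrite !minkE mink_e1l (minkC x) m0 mm mx; ring.
Qed.

(** [<H, n>] is constant: [H_u] and [H_v] are orthogonal to [n], [n] does not
depend on [u], and [n_v] is a multiple of [l'], hence tangent and orthogonal
to [H]. *)
Lemma parallel_curvature_ratio_constant u v u' v' :
  I u -> J v -> I u' -> J v' ->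
  kappa v / f u = kappa v' / f u'.
Proof.
move=> Iu Jv Iu' Jv'; case: (hS) => lP [Iitv _] _ _ _.
have [_ [Jitv _] _ _] := lP.
have E : mink (H u v) (n v) = mink (H u' v') (n v').
  apply: (@constant_on_rectangle R I J (fun u v => mink (H u v) (n v))
    (fun u v => mink (d_u H u v) (n v) + mink (H u v) 0)
    (fun u v => mink (d_v H u v) (n v)
      + mink (H u v) ((e * kappa v) *: l' v)) Iitv Jitv) => //;
    move=> {u v u' v' Iu Jv Iu' Jv'} u v Iu Jv.
  - have D := is_derive_curvature_vector_u v Iu.
    exact: (is_derive1_mink D (is_derive_cst (n v) u 1)).
  - have D := is_derive_curvature_vector_v u Jv.
    exact: (is_derive1_mink D (is_derive_curve_normal lP Jv)).
  - rewrite mink0r addr0.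
    apply: mink_normal_tangent (parallel_d_u_tangent Iu Jv).
    by apply: curve_normal_is_normal => //; exact: nbhs_singleton Iu.
  - have Jv' := nbhs_singleton Jv.
    rewrite (mink_normal_tangent _ (parallel_d_v_tangent Iu Jv)); last first.
      exact: curve_normal_is_normal.
    have /is_normalP[_] := curvature_vector_is_normal Iu Jv'.
    rewrite meridian_d_v // !minkZr => /eqP.
    rewrite mulf_eq0 (negbTE (f_neq0 Iu)) /= => /eqP ->.
    by rewrite mulr0 addr0.
move: E; rewrite [LHS]curvature_vector_curve_normal //.
rewrite [RHS]curvature_vector_curve_normal //.
move: (kappa v) (kappa v') (f u) (f u') e_neq0 => k k' r r' e0 /oppr_inj.
have h0 : (2^-1 : R) != 0 by rewrite invr_eq0 pnatr_eq0.
by rewrite -!mulrA => /(mulfI h0) /(mulfI e0).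
Qed.

Lemma meridian_normal_norm u v : J v ->
  mink (meridian_normal u v) (meridian_normal u v) = e * meridian_speed u.
Proof.
move=> Jv; have [l0 ll _ _ _] := l_facts Jv.
rewrite /meridian_normal /meridian_speed.
move: (l v) (f' u) (g' u) l0 ll => x df dg x0 xx.
by rewrite !minkE !mink_e1l !mink_e1r x0 xx !e1E; ring: ee.
Qed.

(** [nu] and [n] are orthogonal and spacelike, so [4 <H, H>] is a sum of two
nonnegative terms. *)
Lemma curvature_vector_definite u v : I u -> J v ->
  mink (H u v) (H u v) = 0 -> H u v = 0.
Proof.
move=> Iu Jv; case: (hS) => lP _ _ _ hE.
have [n0 nn nl _] := curve_normal_facts lP Jv.
have := meridian_normal_norm u Jv; have [_ E0] := hE _ Iu.
have : mink (meridian_normal u v) (n v) = 0.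
  rewrite /meridian_normal; move: (n v) (l v) n0 nl => m x m0 mx.
  by rewrite !minkE mink_e1l (minkC x) m0 mx; ring.
rewrite /meridian_curvature_vector.
move: (meridian_normal u v) (n v) (meridian_bending u) (e * kappa v / f u)
  nn E0.
move: (e * meridian_speed u) => E w m A k mm E0 wm ww.
rewrite !minkE (minkC m w) ww mm wm => h.
have hA : A ^+ 2 * E + k ^+ 2 = 0 by lra.
have kk : 0 <= k ^+ 2 by exact: sqr_ge0.
have AE : 0 <= A ^+ 2 * E by rewrite mulr_ge0 ?sqr_ge0 ?ltW.
have /eqP : k ^+ 2 = 0 by lra.
rewrite sqrf_eq0 => /eqP ->; have /eqP : A ^+ 2 * E = 0 by lra.
rewrite mulf_eq0 sqrf_eq0 (gt_eqF E0) orbF => /eqP ->.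
by rewrite !scale0r subr0 scaler0.
Qed.

Lemma parallel_CMC : ~ minimal_surface I J z -> CMC_surface I J z.
Proof.
move=> nmin.
case: (hS) => -[_ [_ [v0 [_ [Jv0 _ _]]]] _ _] [_ [u0 [_ [Iu0 _ _]]]] _ _ _.
exists (mink (H u0 v0) (H u0 v0)); split; last first.
  by move=> u v Iu Jv; rewrite (meridian_mean_curvature Iu Jv);
    exact: (parallel_norm_constant Iu Jv Iu0 Jv0).
(* If the constant were zero, H would vanish everywhere. *)
apply/eqP => c0; apply: nmin => u v Iu Jv.
rewrite (meridian_mean_curvature Iu Jv).
apply: (curvature_vector_definite Iu Jv).
by rewrite (parallel_norm_constant Iu Jv Iu0 Jv0).
Qed.

(** A curve of constant geodesic curvature on a pseudosphere is planar; this
vector is orthogonal to its plane. *)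
Definition curve_axis (v : R) : 'rV[R]_4 := n v - (e * kappa v) *: l v.

Lemma mink_meridian_axis u v v' : J v -> curve_axis v = curve_axis v' ->
  mink (z u v) (curve_axis v') = - (kappa v * f u).
Proof.
move=> Jv <-; have [l0 ll _ _ _] := l_facts Jv.
case: hS => lP _ _ _ _; have [n0 _ nl _] := curve_normal_facts lP Jv.
rewrite /meridian_surface /curve_axis.
move: (n v) (l v) (kappa v) n0 nl l0 ll => m x k m0 mx x0 xx.
by rewrite !minkE !mink_e1l (minkC x m) m0 mx x0 xx; ring: ee.
Qed.

Lemma curve_axis_neq0 v : J v -> curve_axis v != 0.
Proof.
move=> Jv; case: hS => lP _ _ _ _; have [_ nn nl _] := curve_normal_facts lP Jv.
have : mink (curve_axis v) (n v) = 1.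
  rewrite /curve_axis; move: (n v) (l v) nn nl => m x mm mx.
  by rewrite !minkE (minkC x m) mm mx; ring.
by apply: contra_eqN => /eqP ->; rewrite mink0l eq_sym oner_eq0.
Qed.

Lemma parallel_curvature_constant v v' : J v -> J v' -> kappa v = kappa v'.
Proof.
move=> Jv Jv'; case: (hS) => _ [_ [u0 [_ [Iu0 _ _]]]] _ _ _.
apply: (mulIf (invr_neq0 (f_neq0 Iu0))).
exact: parallel_curvature_ratio_constant.
Qed.

(** Once [kappa] is constant, the derivative of [n - e kappa l] is
[e kappa l' - e kappa l' = 0]. *)
Lemma curve_axis_constant v v' : J v -> J v' -> curve_axis v = curve_axis v'.
Proof.
move=> Jv Jv'; case: (hS) => lP _ _ _ _; have [_ [Jitv _] _ _] := lP.
rewrite /curve_axis (parallel_curvature_constant Jv' Jv).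
apply/rowP => j; pose k := kappa v.
apply: (constant_of_derive0_on_interval
  (h := fun s => (n s - (e * k) *: l s) 0 j)
  (dh := fun s => ((e * kappa s) *: l' s - (e * k) *: l' s) 0 j) Jitv) => //.
  move=> t Jt; have Dn := is_derive_curve_normal lP Jt.
  have Dl := is_derive1_scaler (- (e * k)) (smooth_on_is_derive smooth_l Jt).
  have /is_derive_rowP /(_ j) := is_derive1_add Dn Dl.
  by rewrite scaleNr; under eq_fun do rewrite scaleNr.
move=> t nJt; have Jt := nbhs_singleton nJt.
by rewrite (parallel_curvature_constant Jt Jv) subrr mxE.
Qed.

(** On the surface [<z, m> = - kappa f] for the constant axis [m] of the
curve.  The right-hand side is constant because [kappa] is, and because
[kappa / f] is constant, so that [f] is constant unless [kappa = 0]. *)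
Lemma parallel_lies_in_hyperplane : lies_in_hyperplane I J z.
Proof.
case: (hS) => -[_ [_ [v0 [_ [Jv0 _ _]]]] _ _] [_ [u0 [_ [Iu0 _ _]]]] _ _ _.
exists [set x | mink x (curve_axis v0) = mink (z u0 v0) (curve_axis v0)].
split; first exact/mink_kernel_is_hyperplane/curve_axis_neq0.
move=> u v Iu Jv /=.
rewrite (mink_meridian_axis _ Jv (curve_axis_constant Jv Jv0)).
rewrite (mink_meridian_axis _ Jv0 erefl).
rewrite (parallel_curvature_constant Jv Jv0); congr (- _).
have := parallel_curvature_ratio_constant Iu Jv0 Iu0 Jv0.
have [->|k0] := eqVneq (kappa v0) 0; first by rewrite !mul0r.
by move=> /(mulfI k0) /invr_inj ->.
Qed.

End MeridianSurface.

Lemma first_kind_hyperbolic_type (R : realType) (I J : set R) (f g : R -> R)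
    (l : R -> 'rV[R]_4) :
  first_kind I J f g l -> hyperbolic_type 1 I J f g l.
Proof.
move=> [[Iitv Jitv [fs gs ls f0]] E0 ldS l'l']; split=> //.
  split=> //; first by left.
  move=> v Jv; have [lS ll] := ldS _ Jv.
  by split; [exact: span_e2_e3_e4_coord0|exact: ll|exact: l'l'].
move=> u Iu; split; first exact: f0.
rewrite /meridian_speed !mul1r -!expr2 lt_neqAle eq_sym E0 //=.
by rewrite addr_ge0 ?sqr_ge0.
Qed.

Lemma second_kind_hyperbolic_type (R : realType) (I J : set R) (f g : R -> R)
    (l : R -> 'rV[R]_4) :
  timelike_second_kind I J f g l -> hyperbolic_type (-1) I J f g l.
Proof.
move=> [[Iitv Jitv [fs gs ls f0]] E0 lhyp l'l']; split=> //.
  split=> //; first by right.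
  move=> v Jv; have [lS ll _] := lhyp _ Jv.
  by split; [exact: span_e2_e3_e4_coord0|exact: ll|rewrite opprK l'l'].
move=> u Iu; split; first exact: f0.
by rewrite /meridian_speed !mulN1r -!expr2 opprD opprK; exact: E0.
Qed.

Theorem corollary8p3 (R : realType) (I J : set R) (f g : R -> R)
    (l : R -> 'rV[R]_4)
    (hkind : first_kind I J f g l \/ timelike_second_kind I J f g l)
    (hnonmin : ~ minimal_surface I J (meridian_surface f g l))
    (hparallel : parallel_mean_curvature I J (meridian_surface f g l)) :
  CMC_surface I J (meridian_surface f g l) /\
  lies_in_hyperplane I J (meridian_surface f g l).
Proof.
have [e hS] : exists e, hyperbolic_type e I J f g l.
  case: hkind => [/first_kind_hyperbolic_type|/second_kind_hyperbolic_type] hS.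
    by exists 1.
  by exists (-1).
split; [exact: parallel_CMC hS _ _|exact: parallel_lies_in_hyperplane hS _].
Qed.
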